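(* Let $\mathcal{D}$ be a small category with split-epi/mono factorizations (every map factors as a split epimorphism followed by a monomorphism). If $\mathcal{C}\to\mathcal{D}$ is a full subcategory closed under subobjects, then its successor is the (full) subcategory of $\mathcal{D}$ consisting of the objects $D$ in $\mathcal{D}$ such that: for every monomorphism $f:C\to D$ with codomain $D$, $C$ is in $\mathcal{C}$ or $f$ is an isomorphism. In particular, as a function on the poset of (full and closed-under-subobjects) subcategories of $\mathcal{D}$, the successor is monotone increasing.
   Context: A full subcategory $\mathcal{C}$ of $\mathcal{D}$ is closed under subobjects if, for every monomorphism $D\to C$ in $\mathcal{D}$ with $C$ in $\mathcal{C}$, $D$ is in $\mathcal{C}$. The poset of such subcategories is ordered by inclusion, and monotone increasing means order-preserving. $\widehat{\mathcal{D}}$ is the topos of presheaves of sets on $\mathcal{D}$. For a full subcategory $\mathcal{C}\to\mathcal{D}$ closed under subobjects, let $\mathcal{I}$ be the ideal of all maps of $\mathcal{D}$ that factor through some object of $\mathcal{C}$, and $\mathcal{I}(-,D)$ the sieve of maps in $\mathcal{I}$ with codomain $D$. Consider the Grothendieck topology on $\mathcal{D}$ in which a sieve on $D$ covers if and only if it contains $\mathcal{I}(-,D)$. For it every presheaf $X$ has a least dense subobject $\ell_X$; these are the components of the counit $\ell$ of an idempotent comonad on $\widehat{\mathcal{D}}$ (the principal comonad induced by $\mathcal{I}$). The subobject $\ell_X$ consists of the $\mathcal{I}$-generated elements, i.e. those $x\in XD$ of the form $x=y\cdot f$ with $f:D\to E$ in $\mathcal{I}$ and $y\in XE$, where $y\cdot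 f=X(f)(y)$. A map $f:Y\to X$ in $\widehat{\mathcal{D}}$ is on top of $\ell$ if, for every subobject $u$ of $X$, $f$ factors through the subobject $u\vee(u\Rightarrow\ell_X)$, where $\Rightarrow$ is the implication in the Heyting algebra of subobjects of $X$. A map $f$ in $\mathcal{D}$ is on top of $\ell$ if $\mathcal{D}(-,f)$ is on top of $\ell$. The successor of $\mathcal{C}\to\mathcal{D}$ is the full subcategory $\mathcal{C}'\to\mathcal{D}$ consisting of the objects $D$ of $\mathcal{D}$ such that $id_D$ is on top of $\ell$. *)

(* Defs.v *)
From Stdlib Require Import ProofIrrelevance.

Set Implicit Arguments.
Unset Strict Implicit.
Unset Printing Implicit Defensive.

(** * Small categories *)

Record Category := {
  Ob :> Type;
  Hom : Ob -> Ob -> Type;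
  idm : forall A, Hom A A;
  comp : forall A B E, Hom B E -> Hom A B -> Hom A E;
  comp_idl : forall A B (f : Hom A B), comp (idm B) f = f;
  comp_idr : forall A B (f : Hom A B), comp f (idm A) = f;
  comp_assoc : forall A B E F (h : Hom E F) (g : Hom B E) (f : Hom A B),
    comp h (comp g f) = comp (comp h g) f
}.
Arguments Hom {c} A B.
Arguments idm {c} A.

Notation "g \c f" := (comp g f) (at level 40, left associativity).

Definition mono (D : Category) (A B : D) (m : Hom A B) : Prop :=
  forall (Z : D) (g h : Hom Z A), m \c g = m \c h -> g = h.

Definition split_epi (D : Category) (A B : D) (e : Hom A B) : Prop :=
  exists s : Hom B A, e \c s = idm B.

Definition iso (D : Category) (A B : D) (f : Hom A B) : Prop :=
  exists g : Hom B A, g \c f = idm A /\ f \c g = idm B.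

Definition split_epi_mono_factorizations (D : Category) : Prop :=
  forall (A B : D) (f : Hom A B),
    exists (E : D) (e : Hom A E) (m : Hom E B),
      split_epi e /\ mono m /\ f = m \c e.

(** A full subcategory is given by its class of objects. *)

Definition FullSubcat (D : Category) := Ob D -> Prop.

Definition closed_under_subobjects (D : Category) (C : FullSubcat D) : Prop :=
  forall (A B : D) (m : Hom A B), mono m -> C B -> C A.

Definition subcat_le (D : Category) (C1 C2 : FullSubcat D) : Prop :=
  forall A : D, C1 A -> C2 A.

(** * Presheaves and their maps *)

Record Presheaf (D : Category) := {
  elt :> Ob D -> Type;
  act : forall A B, elt B -> Hom A B -> elt A;
  act_id : forall A (x : elt A), act x (idm A) = x;
  act_comp : forall A B E (x : elt E) (g : Hom B E) (f : Hom A B),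
    act x (g \c f) = act (act x g) f
}.

Notation "x \a f" := (act x f) (at level 40, left associativity).

Record PshMap (D : Category) (Y X : Presheaf D) := {
  psh_fun :> forall A : D, Y A -> X A;
  psh_nat : forall (A B : D) (y : Y B) (f : Hom A B),
    psh_fun (y \a f) = psh_fun y \a f
}.

Definition yo (D : Category) (B : D) : Presheaf D :=
  {| elt := fun A => Hom A B;
     act := fun A A' (g : Hom A' B) (f : Hom A A') => g \c f;
     act_id := fun A g => comp_idr g;
     act_comp := fun A A' A'' k g f => comp_assoc k g f |}.

Definition yo_map (D : Category) (B B' : D) (f : Hom B B') :
    PshMap (yo B) (yo B') :=
  {| psh_fun := fun A (g : yo B A) => (f \c g : yo B' A);
     psh_nat := fun A A' y g => comp_assoc f y g |}.

(** * Subobjects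

    Subobjects in a presheaf topos are represented by subfunctors. *)

Record Subobject (D : Category) (X : Presheaf D) := {
  mem : forall A : D, X A -> Prop;
  mem_act : forall (A B : D) (x : X B) (f : Hom A B), mem x -> mem (x \a f)
}.
Arguments mem {D X} u {A} x : rename.

Definition sub_le (D : Category) (X : Presheaf D) (u v : Subobject X) : Prop :=
  forall (A : D) (x : X A), mem u x -> mem v x.

Definition sub_meet (D : Category) (X : Presheaf D) (u v : Subobject X) :
  Subobject X.
Proof.
  refine {| mem := fun A x => mem u x /\ mem v x |}.
  intros A B x f [Hu Hv]; split; apply mem_act; assumption.
Defined.

Definition sub_join (D : Category) (X : Presheaf D) (u v : Subobject X) :
  Subobject X.
Proof.
  refine {| mem := fun A x => mem u x \/ mem v x |}.
  intros A B x f [Hu | Hv]; [left | right]; apply mem_act; assumption.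
Defined.

(** The Heyting implication: the union of all [w] with [w /\ u <= v]. *)
Definition sub_imp (D : Category) (X : Presheaf D) (u v : Subobject X) :
  Subobject X.
Proof.
  refine {| mem := fun A x =>
    exists w : Subobject X, sub_le (sub_meet w u) v /\ mem w x |}.
  intros A B x f [w [Hw Hx]]; exists w; split;
    [exact Hw | apply mem_act; exact Hx].
Defined.

Lemma sub_impP (D : Category) (X : Presheaf D) (w u v : Subobject X) :
  sub_le w (sub_imp u v) <-> sub_le (sub_meet w u) v.
Proof.
  split.
  - intros H A x [Hw Hu]. destruct (H A x Hw) as [w' [Hw' Hx]].
    apply Hw'; split; assumption.
  - intros H A x Hx. exists w; split; assumption.
Qed.

Definition sub_psh (D : Category) (X : Presheaf D) (u : Subobject X) :
  Presheaf D.
Proof.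
  refine {| elt := fun A => {x : X A | mem u x};
            act := fun A B x f =>
              exist _ (proj1_sig x \a f) (mem_act f (proj2_sig x)) |}.
  - intros A [x Hx]; apply subset_eq_compat; apply act_id.
  - intros A B E [x Hx] g f; apply subset_eq_compat; apply act_comp.
Defined.

Definition sub_incl (D : Category) (X : Presheaf D) (u : Subobject X) :
    PshMap (sub_psh u) X :=
  {| psh_fun := fun A (x : sub_psh u A) => proj1_sig x;
     psh_nat := fun A B x f => eq_refl |}.

Definition factors_through (D : Category) (Y X : Presheaf D)
    (f : PshMap Y X) (u : Subobject X) : Prop :=
  exists g : PshMap Y (sub_psh u),
    forall (A : D) (y : Y A), f A y = sub_incl u A (g A y).

Lemma factors_throughP (D : Category) (Y X : Presheaf D)
    (f : PshMap Y X) (u : Subobject X) :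
  factors_through f u <-> forall (A : D) (y : Y A), mem u (f A y).
Proof.
  split.
  - intros [g Hg] A y. rewrite Hg. exact (proj2_sig (g A y)).
  - intros H.
    unshelve eexists {| psh_fun := fun A y =>
      (exist _ (f A y) (H A y) : sub_psh u A) |}.
    + intros A B y h; apply subset_eq_compat; apply psh_nat.
    + reflexivity.
Qed.

(** * Grothendieck topologies and dense subobjects *)

Definition Sieve (D : Category) (B : D) := Subobject (yo B).

Definition max_sieve (D : Category) (B : D) : Sieve B :=
  @Build_Subobject D (yo B) (fun _ _ => True) (fun _ _ _ _ _ => I).

(** The sieve of all [f] with [x \a f] in [u].  When [u] is a sieve on [B], an
    element [x] of [yo B] is a map to [B] and this is the pullback of [u]
    along [x]. *)
Definition elt_sieve (D : Category) (X : Presheaf D) (u : Subobject X)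
  (B : D) (x : X B) : Sieve B.
Proof.
  refine (@Build_Subobject D (yo B) (fun A (f : Hom A B) => mem u (x \a f)) _).
  intros A A' f g H; simpl. rewrite act_comp. apply mem_act; exact H.
Defined.

Record Topology (D : Category) := {
  covers : forall B : D, Sieve B -> Prop;
  covers_max : forall B : D, covers (max_sieve B);
  covers_pullback : forall (A B : D) (S : Sieve B) (h : yo B A),
    covers S -> covers (elt_sieve S h);
  covers_trans : forall (B : D) (S T : Sieve B), covers S ->
    (forall (A : D) (h : yo B A), mem S h -> covers (elt_sieve T h)) ->
    covers T
}.

Definition dense (D : Category) (J : Topology D) (X : Presheaf D)
    (u : Subobject X) : Prop :=
  forall (B : D) (x : X B), covers J (elt_sieve u x).

(** The meet of all dense subobjects; in general it need not be dense. *)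
Definition dense_meet (D : Category) (J : Topology D) (X : Presheaf D) :
  Subobject X.
Proof.
  refine {| mem := fun A x => forall u : Subobject X, dense J u -> mem u x |}.
  intros A B x f H u Hu; apply mem_act; apply H; exact Hu.
Defined.

(** * The ideal, its topology and the least dense subobjects *)

Definition in_ideal (D : Category) (C : FullSubcat D) (A B : D)
    (f : Hom A B) : Prop :=
  exists (E : D) (g : Hom E B) (h : Hom A E), C E /\ f = g \c h.

Definition ideal_sieve (D : Category) (C : FullSubcat D) (B : D) : Sieve B.
Proof.
  refine (@Build_Subobject D (yo B) (fun A (f : Hom A B) => in_ideal C f) _).
  intros A A' f k [E [g [h [HE Hf]]]].
  exists E, g, (h \c k); split; [exact HE |].
  simpl; rewrite Hf; symmetry; apply comp_assoc.
Defined.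

Definition ideal_topology (D : Category) (C : FullSubcat D) : Topology D.
Proof.
  refine {| covers := fun B S => sub_le (ideal_sieve C B) S |}.
  - intros B A f _; exact I.
  - intros A B S h HS A' f [E [g [k [HE Hf]]]]; simpl.
    apply HS. exists E, (h \c g), k; split; [exact HE |].
    rewrite Hf; apply comp_assoc.
  - intros B S T HS HT A f [E [g [k [HE Hf]]]].
    rewrite Hf. apply (HT E g).
    + apply HS. exists E, g, (idm E).
      split; [exact HE | symmetry; apply comp_idr].
    + exists E, (idm E), k. split; [exact HE | symmetry; apply comp_idl].
Defined.

Definition ell (D : Category) (C : FullSubcat D) (X : Presheaf D) :
  Subobject X := dense_meet (ideal_topology C) X.

Definition generated (D : Category) (C : FullSubcat D) (X : Presheaf D) :
  Subobject X.
Proof.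
  refine {| mem := fun A x =>
    exists (E : D) (f : Hom A E) (y : X E), in_ideal C f /\ x = y \a f |}.
  intros A B x k [E [f [y [Hf Hx]]]].
  exists E, (f \c k), y; split.
  - exact (mem_act (s := ideal_sieve C E) k Hf).
  - rewrite Hx; symmetry; apply act_comp.
Defined.

Lemma generated_dense (D : Category) (C : FullSubcat D) (X : Presheaf D) :
  dense (ideal_topology C) (generated C X).
Proof.
  intros B x A f Hf. exists B, f, x; split; [exact Hf | reflexivity].
Qed.

Lemma ellP (D : Category) (C : FullSubcat D) (X : Presheaf D) (A : D)
    (x : X A) :
  mem (ell C X) x <->
  exists (E : D) (f : Hom A E) (y : X E), in_ideal C f /\ x = y \a f.
Proof.
  split.
  - intros H. exact (H (generated C X) (@generated_dense D C X)).
  - intros [E [f [y [Hf Hx]]]] u Hu. rewrite Hx. exact (Hu E y A f Hf).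
Qed.

Lemma ell_dense (D : Category) (C : FullSubcat D) (X : Presheaf D) :
  dense (ideal_topology C) (ell C X).
Proof.
  intros B x A f Hf. apply (proj2 (ellP C (x \a f))).
  exists B, f, x; split; [exact Hf | reflexivity].
Qed.

Lemma ell_least (D : Category) (C : FullSubcat D) (X : Presheaf D)
    (u : Subobject X) :
  dense (ideal_topology C) u -> sub_le (ell C X) u.
Proof. intros Hu A x Hx; exact (Hx u Hu). Qed.

(** * Maps on top of [ell] and the successor *)

Definition psh_on_top (D : Category) (C : FullSubcat D) (Y X : Presheaf D)
    (f : PshMap Y X) : Prop :=
  forall u : Subobject X,
    factors_through f (sub_join u (sub_imp u (ell C X))).

Definition on_top (D : Category) (C : FullSubcat D) (A B : D)
    (f : Hom A B) : Prop :=
  psh_on_top C (yo_map f).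

Definition successor (D : Category) (C : FullSubcat D) : FullSubcat D :=
  fun B => on_top C (idm B).

(* Main.v *)
From Stdlib Require Import Classical.
Require Import Defs.

(** By Yoneda, subobjects of the representable at [B] are sieves on [B], and
    the least dense one is the sieve [I(-,B)] of maps that factor through [C].
    The identity of [B] is on top of it exactly when every sieve on [B] is
    either maximal or contained in [I(-,B)] ([successor_sieveP]).

    Split-epi/mono factorizations reduce this dichotomy to principal sieves on
    monomorphisms: if a sieve contains [m \c e] and [s] is a section of [e], it
    contains [m = m \c e \c s].  For the sieve generated by a mono [f : A -> B],
    being maximal means that [f] is a split epi, hence an iso, and being
    contained in [I(-,B)] means that [f] factors through some object of [C], so
    that [A] is a subobject of that object and lies in [C].

    The resulting description of the successor mentions [C] only positively,
    whence monotonicity; and if [m \c f] is an iso with [m] mono, then [f] is an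
    iso, whence closure under subobjects. *)

Lemma mono_comp (D : Category) (A B E : D) (g : Hom B E) (f : Hom A B) :
  mono g -> mono f -> mono (g \c f).
Proof.
  intros Hg Hf Z h k H. apply Hf, Hg. now rewrite !comp_assoc.
Qed.

Lemma mono_of_comp (D : Category) (A B E : D) (g : Hom B E) (f : Hom A B) :
  mono (g \c f) -> mono f.
Proof.
  intros H Z h k Hhk. apply H. now rewrite <- !comp_assoc, Hhk.
Qed.

Lemma mono_split_epi_iso (D : Category) (A B : D) (f : Hom A B) :
  mono f -> split_epi f -> iso f.
Proof.
  intros Hf [s Hs]. exists s; split; [| exact Hs].
  apply Hf. now rewrite comp_assoc, Hs, comp_idl, comp_idr.
Qed.

Lemma iso_of_comp_mono (D : Category) (A B E : D) (g : Hom B E)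
    (f : Hom A B) :
  mono g -> iso (g \c f) -> iso f.
Proof.
  intros Hg [k [Hl Hr]]. exists (k \c g); split.
  - now rewrite <- comp_assoc.
  - apply Hg. now rewrite !comp_assoc, Hr, comp_idl, comp_idr.
Qed.

Lemma ell_yo (D : Category) (C : FullSubcat D) (A B : D) (f : yo B A) :
  mem (ell C (yo B)) f <-> in_ideal C f.
Proof.
  rewrite ellP. split.
  - intros [E [g [y [[F [k [h [HF Hg]]]] Hf]]]].
    exists F, (y \c k), h; split; [exact HF |].
    rewrite Hf, Hg. apply comp_assoc.
  - intros Hf. exists B, f, (idm B). split; [exact Hf |].
    symmetry; apply comp_idl.
Qed.

(** A subobject of the representable at [B] contains all of it as soon as it
    contains the identity, so only the membership of [idm B] in
    [u \/ (u => ell)] matters. *)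
Lemma successor_sieveP (D : Category) (C : FullSubcat D) (B : D) :
  successor C B <->
  (forall u : Sieve B, mem u (idm B : yo B B) \/ sub_le u (ideal_sieve C B)).
Proof.
  split.
  - intros H u.
    destruct (proj1 (factors_throughP _ _) (H u) B (idm B)) as [Hu | Hw];
      cbn in *; rewrite comp_idl in *; [now left | right].
    destruct Hw as [w [Hwu Hw]]. intros A f Hf.
    apply ell_yo, Hwu. split; [| exact Hf].
    rewrite <- (comp_idl f). exact (mem_act f Hw).
  - intros H u. apply factors_throughP. intros A f.
    destruct (H u) as [Hu | Hu].
    + left. exact (mem_act f Hu).
    + right. exists (max_sieve B). split; [| exact I].
      intros A' g [_ Hg]. apply ell_yo, Hu, Hg.
Qed.

Definition principal_sieve (D : Category) (A B : D) (f : Hom A B) : Sieve B.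
Proof.
  refine (@Build_Subobject D (yo B)
    (fun Z (g : Hom Z B) => exists h : Hom Z A, g = f \c h) _).
  intros Z Z' g k [h Hh]. exists (h \c k). cbn.
  rewrite Hh. symmetry; apply comp_assoc.
Defined.

Lemma successor_mono_dichotomy (D : Category) (C : FullSubcat D) :
  closed_under_subobjects C -> forall B : D, successor C B ->
  forall (A : D) (f : Hom A B), mono f -> C A \/ iso f.
Proof.
  intros HC B HB A f Hf.
  destruct (proj1 (successor_sieveP D C B) HB (principal_sieve D A B f))
    as [[s Hs] | H].
  - right. apply mono_split_epi_iso; [exact Hf |]. now exists s.
  - left. destruct (H A f) as [E [g [h [HE Hgh]]]].
    + exists (idm A). symmetry; apply comp_idr.
    + apply (HC A E h); [| exact HE].
      apply (mono_of_comp D A E B g h). now rewrite <- Hgh.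
Qed.

Lemma mono_dichotomy_successor (D : Category) (C : FullSubcat D) :
  split_epi_mono_factorizations D -> forall B : D,
  (forall (A : D) (f : Hom A B), mono f -> C A \/ iso f) -> successor C B.
Proof.
  intros HD B HB. apply successor_sieveP. intros u.
  destruct (classic (mem u (idm B : yo B B))) as [Hu | Hu]; [now left | right].
  intros A f Hf. destruct (HD A B f) as [E [e [m [[s Hs] [Hm Hfe]]]]].
  assert (Hum : mem u (m : yo B E)).
  { replace m with (f \c s) by now rewrite Hfe, <- comp_assoc, Hs, comp_idr.
    exact (mem_act s Hf). }
  destruct (HB E m Hm) as [HE | [k [_ Hk]]].
  - now exists E, m, e.
  - destruct Hu. rewrite <- Hk. exact (mem_act k Hum).
Qed.

Theorem theorem5p3 (D : Category) (hD : split_epi_mono_factorizations D) :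
  (forall C : FullSubcat D, closed_under_subobjects C ->
     forall B : D,
       successor C B <->
       (forall (A : D) (f : Hom A B), mono f -> C A \/ iso f)) /\
  (forall C : FullSubcat D, closed_under_subobjects C ->
     closed_under_subobjects (successor C)) /\
  (forall C1 C2 : FullSubcat D,
     closed_under_subobjects C1 -> closed_under_subobjects C2 ->
     subcat_le C1 C2 -> subcat_le (successor C1) (successor C2)).
Proof.
  split; [| split].
  - intros C HC B. split.
    + now apply successor_mono_dichotomy.
    + now apply mono_dichotomy_successor.
  - intros C HC A B m Hm HB. apply mono_dichotomy_successor; [exact hD |].
    intros Z f Hf.
    destruct (successor_mono_dichotomy D C HC B HB Z (m \c f)) as [HZ | Hi].
    + now apply mono_comp.
    + now left.
    + right. now apply (iso_of_comp_mono D Z A B m f).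
  - intros C1 C2 H1 _ Hle B HB. apply mono_dichotomy_successor; [exact hD |].
    intros A f Hf.
    destruct (successor_mono_dichotomy D C1 H1 B HB A f Hf) as [HA | Hi].
    + left. now apply Hle.
    + now right.
Qed.
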